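(* Let $X$ be a Fréchet sequence space over $\mathbb{Z}$ in which the unit sequences $(e_n)_{n\in\mathbb{Z}}$ form an unconditional basis. Let $w=(w_n)_{n\in\mathbb{Z}}$ be a sequence of non-zero scalars such that the bilateral weighted backward shift $B_w$, $B_w(x_n)_{n\in\mathbb{Z}}=(w_{n+1}x_{n+1})_{n\in\mathbb{Z}}$, is a (continuous linear) operator on $X$. Suppose there exist $x\in X$ and a non-zero vector $y\in X$ such that, for every neighbourhood $V$ of $y$, the set \[ \{ n\geq 0 : B_w^n x \in V\} \] is syndetic. Then $B_w$ is chaotic and therefore frequently hypercyclic.
   Context: A Fréchet sequence space over $\mathbb{Z}$ is a Fréchet space that is a linear subspace of the space $\mathbb{K}^{\mathbb{Z}}$ of all real or complex sequences indexed by $\mathbb{Z}$, such that each coordinate functional $x\mapsto x_k$ is continuous; $e_n=(\delta_{n,k})_{k\in\mathbb{Z}}$. A set $A\subset\mathbb{N}_0$ is syndetic if it is non-empty with bounded gaps, i.e. there is $N$ such that every interval of $N$ consecutive non-negative integers meets $A$. An operator $T$ is hypercyclic if some orbit $\{T^nx:n\ge0\}$ is dense; it is chaotic if it is hypercyclic and its set of periodic points is dense; it is frequently hypercyclic if there is $x$ such that for every non-empty open set $U$ the set $\{n\geq 0: T^nx\in U\}$ has positive lower density. *)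

(* Defs.v *)
From HB Require Import structures.
From mathcomp Require Import all_boot all_order all_algebra.
From mathcomp Require Import all_classical all_reals all_analysis.
From mathcomp.real_closed Require Import complex.
Set Implicit Arguments. Unset Strict Implicit. Unset Printing Implicit Defensive.
Import Order.TTheory GRing.Theory Num.Theory.
Import numFieldNormedType.Exports.
Local Open Scope classical_set_scope.
Local Open Scope ring_scope.

(** Fréchet space: a (locally convex, via [tvsType]) Hausdorff topological
    vector space, metrizable (countable neighbourhood base at 0) and complete
    for its translation-invariant uniformity (metrizable, so sequential
    completeness suffices). *)
Definition frechet_space (K : numFieldType) (X : tvsType K) : Prop :=
  [/\ hausdorff_space X,
      (exists B : nat -> set X,
         (forall k, nbhs (0 : X) (B k)) /\
         (forall U, nbhs (0 : X) U -> exists k, B k `<=` U)) &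
      (forall u : nat -> X,
         (forall U, nbhs (0 : X) U ->
            exists N, forall m n, (N <= m)%N -> (N <= n)%N -> U (u m - u n)) ->
         exists l : X, u @ \oo --> l)].

(** [X] is a Fréchet sequence space over Z: [iota] identifies [X] with a
    linear subspace of K^Z (linear, injective), each coordinate functional
    is continuous. *)
Definition frechet_sequence_space (K : numFieldType) (X : tvsType K)
    (iota : X -> int -> K) : Prop :=
  [/\ frechet_space X,
      (forall (a : K) (x y : X) (k : int),
         iota (a *: x + y) k = a * iota x k + iota y k),
      injective iota &
      (forall k : int, continuous (fun x : X => iota x k))].

(** The unit sequences e_n belong to X ([e n] is the element of X whose
    sequence is the n-th unit sequence) and form an unconditional basis:
    for every x, the series sum_n x_n e_n converges unconditionally to x,
    i.e. the net of finite partial sums (indexed by finite subsets of Z)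
    converges to x. *)
Definition unit_sequences (K : numFieldType) (X : tvsType K)
    (iota : X -> int -> K) (e : int -> X) : Prop :=
  forall n k : int, iota (e n) k = (k == n)%:R.

Definition unconditional_basis (K : numFieldType) (X : tvsType K)
    (iota : X -> int -> K) (e : int -> X) : Prop :=
  forall (x : X) (U : set X), nbhs x U ->
    exists F0 : seq int, forall F : seq int, uniq F -> {subset F0 <= F} ->
      U (\sum_(n <- F) iota x n *: e n).

Definition is_weighted_backward_shift (K : numFieldType) (X : tvsType K)
    (iota : X -> int -> K) (w : int -> K) (T : X -> X) : Prop :=
  forall (x : X) (k : int), iota (T x) k = w (k + 1) * iota x (k + 1).

Definition syndetic (A : set nat) : Prop :=
  A !=set0 /\ exists N : nat, forall m : nat, exists k : nat,
    (m <= k < m + N)%N /\ A k.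

Definition orbit_set (X : Type) (T : X -> X) (x : X) : set X :=
  range (fun n : nat => iter n T x).

Definition hypercyclic (X : topologicalType) (T : X -> X) : Prop :=
  exists x : X, dense (orbit_set T x).

Definition periodic_points (X : Type) (T : X -> X) : set X :=
  [set x | exists n : nat, (0 < n)%N /\ iter n T x = x].

Definition chaotic (X : topologicalType) (T : X -> X) : Prop :=
  hypercyclic T /\ dense (periodic_points T).

Definition count_upto (A : set nat) (N : nat) : nat :=
  \sum_(n < N) (asbool (A n) : nat).

(** positive lower density: liminf_N #(A ∩ [0,N)) / N > 0, i.e. there is
    k > 0 with #(A ∩ [0,N)) >= N / k for all large N. *)
Definition positive_lower_density (A : set nat) : Prop :=
  exists k : nat, (0 < k)%N /\
    exists N0 : nat, forall N : nat, (N0 <= N)%N -> (N <= k * count_upto A N)%N.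

Definition frequently_hypercyclic (X : topologicalType) (T : X -> X) : Prop :=
  exists x : X, forall U : set X, open U -> U !=set0 ->
    positive_lower_density [set n | U (iter n T x)].

Definition theorem3p3_over (K : numFieldType) : Prop :=
  forall (X : tvsType K) (iota : X -> int -> K) (e : int -> X)
         (w : int -> K) (T : X -> X),
    frechet_sequence_space iota ->
    unit_sequences iota e ->
    unconditional_basis iota e ->
    (forall n, w n != 0) ->
    is_weighted_backward_shift iota w T ->
    continuous T ->
    (exists (x y : X), y != 0 /\
       forall V : set X, nbhs y V -> syndetic [set n | V (iter n T x)]) ->
    chaotic T /\ frequently_hypercyclic T.

(* Main.v *)
Require Import Defs.
From mathcomp Require Import all_boot all_order all_algebra.
From mathcomp Require Import all_classical all_reals all_analysis.
From mathcomp.real_closed Require Import complex.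
From mathcomp Require Import zify lra ring.
Set Implicit Arguments. Unset Strict Implicit. Unset Printing Implicit Defensive.
Import Order.TTheory GRing.Theory Num.Theory.
Import numFieldNormedType.Exports.
Local Open Scope classical_set_scope.
Local Open Scope ring_scope.

(** Rescaling the basis by [v] with [w (k + 1) * v (k + 1) = v k] turns [B_w] into
    the unweighted shift [T f_(k + 1) = f_k] for [f_k = v_k e_k].

    Some coordinate of [y] is non-zero, so the coordinates of [x] are bounded
    below on a set with bounded gaps. If [T^n x] is close to [y], equicontinuity
    of the coordinate projections (Banach-Steinhaus) makes the far coordinates of
    [T^n x] contribute little, uniformly in [n]; dividing by the coordinates that
    are bounded below and filling the gaps with finitely many powers of [T] shows
    that far finite sums of the [f_k] are small, i.e. that [sum_k f_k] converges
    unconditionally.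

    It follows that every sequence dominated by some slowly growing [d] is the
    coordinate sequence of a vector, and such a vector is small once its
    coordinates near the origin vanish. Periodic sequences then give a dense set
    of periodic points. A frequently hypercyclic vector is a sequence containing
    every pattern of a countable dense family at a set of positions of positive
    lower density, the large patterns lying far from the other ones. *)

(** * Properties shared by the real and complex scalars *)

Definition archimedean_norm (K : numFieldType) : Prop :=
  forall z : K, exists n : nat, `|z| < n%:R.

(** With generators [1, -1, i, -i], this reduces complex coefficients to weights in [0, 1], which
    convexity can handle. *)
Definition unit_ball_in_positive_span (K : numFieldType) : Prop :=
  exists g : 'I_4 -> K, forall c : K, `|c| <= 1 ->
    exists t : 'I_4 -> K, (forall i, 0 <= t i <= 1) /\ c = \sum_i t i * g i.

Definition separable_scalars (K : numFieldType) : Prop :=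
  exists q : nat -> K, forall (z eps : K), 0 < eps -> exists n, `|z - q n| < eps.

(** * Topological vector spaces *)

Section NeighbourhoodsOfZero.
Variables (K : numFieldType) (X : tvsType K).
Implicit Types (U V W : set X) (x y z : X).

Lemma nbhs0_add U : nbhs (0 : X) U ->
  exists2 V, nbhs (0 : X) V & forall a b, V a -> V b -> U (a + b).
Proof.
move=> U0; have /= := @add_continuous X (0, 0) U.
rewrite addr0 => /(_ U0)[[A B]/= [A0 B0] AB].
exists (A `&` B); first exact: filterI.
by move=> a b [Aa _] [_ Bb]; apply: (AB (a, b)).
Qed.

Lemma nbhs0_scale (c : K) U : nbhs (0 : X) U -> nbhs (0 : X) [set z | U (c *: z)].
Proof.
move=> U0; have /= := @scale_continuous K X (c, 0) U.
rewrite scaler0 => /(_ U0)[[A B]/= [A0 B0] AB].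
apply: filterS B0 => z Bz; apply: (AB (c, z)); split=> //=.
exact: nbhs_singleton.
Qed.

Lemma nbhs0_sub U : nbhs (0 : X) U ->
  exists2 V, nbhs (0 : X) V & forall a b, V a -> V b -> U (a - b).
Proof.
move=> /nbhs0_add[V V0 VU]; exists (V `&` [set z | V (-1 *: z)]).
  by apply: filterI => //; exact: nbhs0_scale.
by move=> a b [Va _] [_]; rewrite /= scaleN1r => Vb; exact: VU.
Qed.

Lemma nbhs0_translate x U : nbhs x U -> nbhs (0 : X) [set z | U (x + z)].
Proof.
move=> Ux; have /= := @add_continuous X (x, 0) U.
rewrite addr0 => /(_ Ux)[[A B]/= [A0 B0] AB].
apply: filterS B0 => z Bz; apply: (AB (x, z)); split=> //=.
exact: nbhs_singleton.
Qed.

Lemma nbhs_translate x U : nbhs (0 : X) U -> nbhs x [set z | U (z - x)].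
Proof.
move=> U0; apply: filterS (nbhsT x U0) => z [u Uu <-] /=.
by rewrite addrC addKr.
Qed.

Lemma nbhs0_absorbing U z : nbhs (0 : X) U ->
  exists2 eps : K, 0 < eps & forall t : K, `|t| < eps -> U (t *: z).
Proof.
move=> U0; have /= := @scale_continuous K X (0, z) U.
rewrite scale0r => /(_ U0)[[A B]/= [A0 B0] AB].
have /nbhs_ballP[eps /= eps0 epsA] := A0.
exists eps => // t teps; apply: (AB (t, z)); split => /=.
  by apply: epsA; rewrite -ball_normE /= sub0r normrN.
exact: nbhs_singleton.
Qed.

Lemma nbhs0_sum (N : nat) U : nbhs (0 : X) U ->
  exists2 V, nbhs (0 : X) V &
    forall a : nat -> X, (forall i, (i < N)%N -> V (a i)) -> U (\sum_(i < N) a i).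
Proof.
elim: N U => [|N IH] U U0.
  by exists setT; [exact: filterT|move=> a _; rewrite big_ord0; exact: nbhs_singleton].
have [V V0 VU] := nbhs0_add U0; have [W W0 WV] := IH V V0.
exists (V `&` W); first exact: filterI.
move=> a aVW; rewrite big_ord_recr /=; apply: VU.
  by apply: WV => i iN; have [] := aVW i (ltnW iN).
by have [] := aVW N (ltnSn N).
Qed.

Definition convex_nbhs0 V := nbhs (0 : X) V /\
  forall a b (t : K), 0 <= t <= 1 -> V a -> V b -> V (t *: a + (1 - t) *: b).

Lemma nbhs0_convex U : nbhs (0 : X) U -> exists2 V, convex_nbhs0 V & V `<=` U.
Proof.
move=> U0; have [B Bconv [Bopen Bbase]] := @locally_convex K X.
have [V /= [BV V0] VU] := Bbase 0 U U0.
exists V => //; split; first by apply: open_nbhs_nbhs; split => //; exact: Bopen.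
move=> a b t t01 Va Vb.
have t01' : Itv.spec (@Itv.num_sem K) (Itv.Real `[0%Z, 1%Z]) t.
  rewrite /= /Itv.num_sem /= in_itv /= t01 andbT realE.
  by case/andP: t01 => ->.
have := Bconv V (mem_set BV) a b (Itv.mk t01') (mem_set Va) (mem_set Vb).
by move=> /set_mem.
Qed.

Lemma convex_nbhs0_scale V z (t : K) :
  convex_nbhs0 V -> 0 <= t <= 1 -> V z -> V (t *: z).
Proof.
move=> [V0 Vc] t01 Vz; have := Vc z 0 t t01 Vz (nbhs_singleton V0).
by rewrite scaler0 addr0.
Qed.

(** The sum is affine in each weight separately, so weight [t n] is an average of the weights 1 and
    0. The translate [v] carries the terms already decided. *)
Lemma convex_subsums V (u : int -> X) (t : int -> K) (r : seq int) v :
  convex_nbhs0 V -> uniq r -> (forall k, 0 <= t k <= 1) ->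
  (forall Q : pred int, V (v + \sum_(k <- r | Q k) u k)) ->
  V (v + \sum_(k <- r) t k *: u k).
Proof.
move=> Vc + t01; elim: r v => [|n r IH] v /=.
  by move=> _ /(_ predT); rewrite !big_nil.
move=> /andP[nr ur] Hsub; rewrite big_cons.
have Hb (b : bool) : V (v + (if b then u n else 0) + \sum_(k <- r) t k *: u k).
  apply: IH => // Q.
  have := Hsub [pred k | if k == n then b else Q k].
  rewrite big_cons /= eqxx -addrA.
  rewrite big_seq_cond.
  rewrite (eq_bigl (fun k => (k \in r) && Q k)); last first.
    by move=> k /=; have [->|//] := eqVneq k n; rewrite (negbTE nr).
  by rewrite -big_seq_cond; case: b; rewrite ?add0r.
have := Vc.2 _ _ (t n) (t01 n) (Hb true) (Hb false).
set s := \sum_(k <- r) _; rewrite addr0.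
suff -> : t n *: (v + u n + s) + (1 - t n) *: (v + s) = v + (t n *: u n + s) by [].
rewrite scalerBl scale1r !scalerDr.
set a := t n *: v; set b := t n *: u n; set c := t n *: s.
by rewrite (addrAC a) [LHS]addrC [LHS]addrA subrK -addrA (addrC s).
Qed.

(* A coefficient bounded by [C] is a positive combination of four fixed scalars
   with weights in [0, 1], and each weighted sum is an average of subset sums. *)
Lemma bounded_multipliers (C : nat) U :
  unit_ball_in_positive_span K -> nbhs (0 : X) U ->
  exists2 V, nbhs (0 : X) V &
    forall (u : int -> X) (c : int -> K) (r : seq int), uniq r ->
      {in r, forall k, `|c k| <= C%:R} ->
      (forall Q : pred int, V (\sum_(k <- r | Q k) u k)) ->
      U (\sum_(k <- r) c k *: u k).
Proof.
move=> [g gP] U0; have [W W0 WU] := nbhs0_sum 4 U0.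
have WU' (a : 'I_4 -> X) : (forall i, W (a i)) -> U (\sum_i a i).
  move=> Wa; have := WU (fun i => a (inord i)).
  under eq_bigr do rewrite inord_val.
  by apply => i _; exact: Wa.
(* [C.+1] instead of [C] keeps the later divisor non-zero when [C = 0]. *)
have W'0 : nbhs (0 : X) [set z | forall i, W ((C.+1%:R * g i) *: z)].
  by apply: filter_forall => i; exact: nbhs0_scale.
have [V Vc VW] := nbhs0_convex W'0; exists V; first by case: Vc.
move=> u c r ur cC Vsub.
have /choice[t tP] : forall k : int, exists t : 'I_4 -> K,
    (forall i, 0 <= t i <= 1) /\ (k \in r -> c k = \sum_i t i * (C.+1%:R * g i)).
  move=> k; have [kr|kr] := boolP (k \in r); last first.
    by exists (fun=> 0); split => [i|]; rewrite ?lexx ?ler01 // (negbTE kr).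
  have [|t [t01 ct]] := gP (c k / C.+1%:R).
    rewrite normrM normfV [`|C.+1%:R|]ger0_norm // ler_pdivrMr ?ltr0Sn // mul1r.
    by apply: le_trans (cC k kr) _; rewrite ler_nat.
  exists t; split => // _; have C0 : C.+1%:R != 0 :> K by rewrite pnatr_eq0.
  rewrite -[LHS](divfK C0) ct mulr_suml; apply: eq_bigr => i _.
  by rewrite -mulrA (mulrC (g i)).
rewrite (_ : \sum_(k <- r) _ =
    \sum_i (C.+1%:R * g i) *: \sum_(k <- r) t k i *: u k); last first.
  rewrite (eq_big_seq (fun k => \sum_i (C.+1%:R * g i) *: (t k i *: u k))).
    by rewrite exchange_big; apply: eq_bigr => i _; rewrite scaler_sumr.
  move=> k kr /=; rewrite (tP k).2 // scaler_suml; apply: eq_bigr => i _.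
  by rewrite scalerA mulrC.
apply: WU' => i; apply: VW.
rewrite -[X in V X]add0r; apply: convex_subsums => //.
  by move=> k; exact: (tP k).1.
by move=> Q; rewrite add0r.
Qed.

End NeighbourhoodsOfZero.

(** * Uniform boundedness principle *)

Section BanachSteinhaus.
Variables (K : numFieldType) (X : tvsType K) (I : Type) (P : I -> X -> X).
Hypothesis frechetX : frechet_space X.
Hypothesis PD : forall i x y, P i (x + y) = P i x + P i y.
Hypothesis PZ : forall i (c : K) x, P i (c *: x) = c *: P i x.
Hypothesis Pcont0 : forall i U, nbhs (0 : X) U -> nbhs (0 : X) [set z | U (P i z)].
Hypothesis Pbounded : forall z U, nbhs (0 : X) U ->
  exists n : nat, forall i, U (n.+1%:R^-1 *: P i z).

(* The usual Baire category argument, with the nested closed balls replaced by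
   translates [a_n + W_n] of neighbourhoods of zero. *)
Lemma banach_steinhaus U : nbhs (0 : X) U ->
  exists2 W, nbhs (0 : X) W & forall i z, W z -> U (P i z).
Proof.
move=> U0; apply: contrapT => noW.
have bad W : nbhs (0 : X) W -> exists i z, W z /\ ~ U (P i z).
  move=> W0; apply: contrapT => H; apply: noW; exists W => // i z Wz.
  by apply: contrapT => Uz; apply: H; exists i, z.
have [_ [B [B0 Bbase]] complete] := frechetX.
have [U1 U10 U1U] := nbhs0_sub U0.
have [U2 U20 U2U1] := nbhs0_sub U10.
have step (n : nat) (a : X) W : nbhs (0 : X) W -> exists a' W',
  [/\ nbhs (0 : X) W', (forall z, W' z -> W (a' - a + z)),
      (forall z z', W' z -> W' z' -> B n (z - z')) &
      exists i, forall z z', W' z -> W' z' -> ~ U2 (n.+1%:R^-1 *: P i (a' + (z + z')))].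
  move=> W0; have [W1 W10 W1W] := nbhs0_add W0.
  have [a' [i [W1a' Pa']]] : exists a' i, W1 (a' - a) /\ ~ U1 (n.+1%:R^-1 *: P i a').
    have [i [z [Wz Uz]]] := bad _ (nbhs0_scale n.+1%:R W10).
    (* If both [a] and [a + (n + 1) z] had scaled images in [U1], their difference would put [P i z]
       in [U]; so one of them serves as [a']. *)
    have [H|H] := pselect (U1 (n.+1%:R^-1 *: P i a)); last first.
      by exists a, i; rewrite subrr; split => //; exact: nbhs_singleton.
    exists (a + n.+1%:R *: z), i; split; first by rewrite addrC addKr.
    move=> H'; apply: Uz; have := U1U _ _ H' H.
    by rewrite -scalerBr PD addrC addKr PZ scalerA mulVf ?scale1r // pnatr_eq0.
  have PU2 : nbhs (0 : X) [set z | U2 (n.+1%:R^-1 *: P i z)].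
    exact: Pcont0 (nbhs0_scale n.+1%:R^-1 U20).
  have [W2 W20 W2P] := nbhs0_add PU2.
  have [W3 W30 W3B] := nbhs0_sub (B0 n).
  exists a', (W1 `&` W2 `&` W3); split.
  - by apply: filterI => //; exact: filterI.
  - by move=> z [[W1z _] _]; exact: W1W.
  - by move=> z z' [_ W3z] [_ W3z']; exact: W3B.
  - exists i => z z' [[_ W2z] _] [[_ W2z'] _] H; apply: Pa'.
    have := U2U1 _ _ H (W2P _ _ W2z W2z').
    by rewrite -scalerBr (PD _ a') addrK.
(* Guarding the relation by the condition on the neighbourhood makes it total, as choice
   requires. *)
pose rel (s : nat * (X * set X)) (s' : X * set X) := nbhs (0 : X) s.2.2 ->
  [/\ nbhs (0 : X) s'.2, (forall z, s'.2 z -> s.2.2 (s'.1 - s.2.1 + z)),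
      (forall z z', s'.2 z -> s'.2 z' -> B s.1 (z - z')) &
      exists i, forall z z', s'.2 z -> s'.2 z' ->
        ~ U2 (s.1.+1%:R^-1 *: P i (s'.1 + (z + z')))].
have /choice[next nextP] : forall s, exists s', rel s s'.
  move=> [n [a W]]; have [W0|W0] := pselect (nbhs (0 : X) W); last first.
    by exists (a, W) => /W0.
  by have [a' [W' H]] := step n a W W0; exists (a', W').
pose st := fix st n : X * set X :=
  if n is m.+1 then next (m, st m) else (0, setT).
have stW n : nbhs (0 : X) (st n).2.
  elim: n => [|n IH] /=; first exact: filterT.
  by have [] := nextP (n, st n) IH.
have stP n := nextP (n, st n) (stW n).
have nested n j z : (st (n + j)%N).2 z -> (st n).2 ((st (n + j)%N).1 - (st n).1 + z).
  elim: j z => [|j IH] z; first by rewrite addn0 subrr add0r.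
  rewrite addnS => Hz; have [_ H _ _] := stP (n + j)%N.
  by have := IH _ (H z Hz); rewrite addrA [X in _ (X + z) -> _]addrC subrKA.
have near_st n m : (n <= m)%N -> (st n).2 ((st m).1 - (st n).1).
  move=> nm; have := @nested n (m - n)%N 0; rewrite subnKC // addr0; apply.
  exact: nbhs_singleton.
have [|l ul] := complete (fun n => (st n).1).
  move=> V V0; have [k Bk] := Bbase V V0; exists k.+1 => m n km kn; apply: Bk.
  have [_ _ H _] := stP k; have := H _ _ (near_st _ _ km) (near_st _ _ kn).
  by rewrite /= opprB addrA subrK.
have [n nP] := Pbounded l U20.
have [_ _ _ [i iP]] := stP n.
(* For large [m], [l = a_(n+1) + (l - a_m) + (a_m - a_(n+1))] with both differences in [W_(n+1)].
   The two summands allowed in [step] replace closedness of the balls. *)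
have /ul := nbhs_translate l (nbhs0_scale (-1) (stW n.+1)).
move=> [N _ /(_ (maxn N n.+1))]; rewrite /= leq_maxl scaleN1r opprB => /(_ isT) Hl.
have := iP _ _ Hl (near_st n.+1 _ (leq_maxr N n.+1)).
by rewrite /= subrKA addrC subrK; apply; exact: nP.
Qed.

End BanachSteinhaus.

(** * Sequences with frequent patterns *)

Lemma count_upto_monotone (A : set nat) (m n : nat) :
  (m <= n)%N -> (count_upto A m <= count_upto A n)%N.
Proof.
move=> /subnKC <-; elim: (n - m)%N => [|j IH]; first by rewrite addn0.
by rewrite addnS /count_upto big_ord_recr /=; exact: leq_trans IH (leq_addr _ _).
Qed.

Lemma positive_lower_density_increasing (A : set nat) (g : nat -> nat) (Q : nat) :
  (forall t, (g t < g t.+1)%N) -> (forall t, A (g t)) ->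
  (forall t, (g t < Q * t.+1)%N) -> positive_lower_density A.
Proof.
move=> g_incr gA gQ.
have Q0 : (0 < Q)%N by case: Q gQ => // /(_ 0%N).
have count_g t : (t < count_upto A (g t).+1)%N.
  elim: t => [|t IH]; rewrite /count_upto big_ord_recr /= asboolT //= addn1 //.
  by rewrite ltnS; apply: leq_trans IH _; exact: count_upto_monotone.
(* For [N >= Q], at least [N %/ Q >= N / (2 Q)] terms of [g] lie below [N]. *)
exists (2 * Q)%N; split; first by rewrite muln_gt0.
exists Q => N QN; have := leq_divM N Q; have := ltn_ceil N Q0.
have : (0 < N %/ Q)%N by rewrite divn_gt0.
case: (N %/ Q)%N => // m _ Nm mN.
have : (m < count_upto A N)%N.
  apply: leq_trans (count_g m) _; apply: count_upto_monotone.
  by apply: leq_trans (gQ m) _; rewrite mulnC.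
nia.
Qed.

Lemma positive_lower_densityS (A B : set nat) :
  A `<=` B -> positive_lower_density A -> positive_lower_density B.
Proof.
move=> AB [k [k0 [N0 H]]]; exists k; split => //; exists N0 => N /H.
move=> /leq_trans; apply; rewrite leq_mul2l; apply/orP; right.
apply: leq_sum => n _; case: asboolP => // /AB Bn; by rewrite asboolT.
Qed.

(** By Legendre's formula. The leftover [n %/ 2 ^ m] added to the partial sum pays for the next term
    and the next leftover. *)
Lemma logn2_fact_le (n : nat) : (logn 2 n`! <= n)%N.
Proof.
rewrite logn_fact //.
suff H m : (\sum_(1 <= k < m.+1) n %/ 2 ^ k + n %/ 2 ^ m <= n)%N.
  exact: leq_trans (leq_addr _ _) (H n).
elim: m => [|m IH]; first by rewrite big_nil expn0 divn1.
rewrite big_nat_recr //=; apply: leq_trans IH.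
rewrite -addnA leq_add2l expnSr divnMA.
by have := leq_divM (n %/ 2 ^ m) 2; lia.
Qed.

(** The ruler sequence: radius [v + 1] recurs with period [2 ^ (v + 1)], so each radius has positive
    density while the mean radius stays bounded. *)
Definition block_radius (k : nat) : nat := (logn 2 k.+1).+1.

(* The [k]-th block is centred here: the blocks of radii [block_radius 0],
   [block_radius 1], ... are laid side by side. *)
Definition block_center (k : nat) : nat :=
  ((k + logn 2 k`!).*2 + block_radius k)%N.

Lemma block_center_sep (i k : nat) : (i < k)%N ->
  (block_center i + block_radius i + block_radius k <= block_center k)%N.
Proof.
(* Hence [j] plus the 2-adic valuation of its factorial is the sum of the radii of the blocks before
   block [j]. *)
have stepS j : (j.+1 + logn 2 j.+1`! = j + logn 2 j`! + block_radius j)%N.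
  by rewrite factS lognM ?fact_gt0 // /block_radius; lia.
have mono j : (i < j)%N -> (i + logn 2 i`! + block_radius i <= j + logn 2 j`!)%N.
  elim: j => // j IH; rewrite ltnS leq_eqVlt => /orP[/eqP ->|/IH]; rewrite stepS //.
  by move=> /leq_trans; apply; rewrite leq_addr.
by move=> /mono; rewrite /block_center; lia.
Qed.

Lemma block_center_lt (k : nat) : (block_center k < 4 * k.+1)%N.
Proof.
have := logn2_fact_le k.+1; rewrite factS lognM ?fact_gt0 //.
rewrite /block_center /block_radius; have := logn2_fact_le k; lia.
Qed.

Definition int_interval (M : nat) : seq int :=
  [seq (i%:Z - M%:Z) | i <- iota 0 (M.*2.+1)].

Lemma mem_int_interval M (k : int) : (k \in int_interval M) = (`|k| <= M)%N.
Proof.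
apply/mapP/idP => [[n]|kM]; first by rewrite mem_iota => ? ->; lia.
by exists (`|(k + M%:Z)%R|)%N; rewrite ?mem_iota; lia.
Qed.

Lemma int_interval_uniq M : uniq (int_interval M).
Proof. by rewrite map_inj_uniq ?iota_uniq // => i j /=; lia. Qed.

Section FrequentPatterns.
Variables (K : numFieldType) (d : nat -> nat) (M : nat -> nat) (p : nat -> int -> K).
Hypothesis archK : archimedean_norm K.
Hypothesis d_mono : forall m n, (m <= n)%N -> (d m <= d n)%N.
Hypothesis d_unbounded : forall C, exists n, (C <= d n)%N.

Let pattern_of (k : nat) : nat := logn 2 (logn 2 k.+1).

(* Centre pattern [pattern_of k] in block [k] whenever the block is wide enough
   for the growth condition; pattern [l] is the one of all blocks of radius
   [v + 1] with [v = 2 ^ l * 3 ^ j], hence of infinitely many radii. *)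
Lemma frequent_patterns : exists c : int -> K,
  (forall m, `|c m| <= (d `|m|%N)%:R) /\
  forall l, positive_lower_density
    [set n : nat | forall k : int,
      ((`|k| <= M l)%N -> c (n%:Z + k) = p l k) /\
      ((M l < `|k|)%N -> `|c (n%:Z + k)| <= (d `|k|%N)%:R)].
Proof.
have /choice[q qP] : forall l, exists q, forall k : int,
    (`|k| <= M l)%N -> `|p l k| <= (d q)%:R.
  move=> l; have [n nP] := archK (\sum_(k <- int_interval (M l)) `|p l k|).
  have [q nq] := d_unbounded n; exists q => k; rewrite -mem_int_interval => kM.
  apply: le_trans (_ : n%:R <= _); last by rewrite ler_nat.
  apply: le_trans (ltW nP); rewrite [leRHS]ger0_norm; last by apply: sumr_ge0 => *.
  rewrite (bigD1_seq k) ?int_interval_uniq //= lerDl.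
  by apply: sumr_ge0 => *.
(* The pattern occupies radius [M l]; the extra margin keeps its values farther than [q l] from 0
   and from every other centre, where [d] dominates them. *)
pose N l := (M l + q l).+1.
pose hit (m : int) k := (N (pattern_of k) <= block_radius k)%N /\
  (`|(m - (block_center k)%:Z)%R| <= M (pattern_of k))%N.
have hit_uniq m i k : hit m i -> hit m k -> i = k.
  wlog : i k / (i <= k)%N.
    by move=> H; case: (leqP i k) => [/H//|/ltnW /H H' ? ?]; rewrite H'.
  rewrite leq_eqVlt => /orP[/eqP //|/block_center_sep sep] [Ni Mi] [Nk Mk].
  by move: Ni Nk; rewrite /N; lia.
have /choice[c cP] : forall m : int, exists v : K,
    (forall k, hit m k -> v = p (pattern_of k) (m - (block_center k)%:Z)) /\
    ((forall k, ~ hit m k) -> v = 0).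
  move=> m; have [[k mk]|nohit] := pselect (exists k, hit m k).
    exists (p (pattern_of k) (m - (block_center k)%:Z)); split.
      by move=> i mi; rewrite (hit_uniq _ _ _ mi mk).
    by move=> /(_ k).
  by exists 0; split => // k mk; case: nohit; exists k.
have c_small (m : int) (b : nat) : (forall k, hit m k -> (q (pattern_of k) <= b)%N) ->
    `|c m| <= (d b)%:R.
  move=> Hb; have [[k mk]|nohit] := pselect (exists k, hit m k); last first.
    by rewrite (cP m).2 ?normr0 // => k mk; apply: nohit; exists k.
  rewrite ((cP m).1 k mk); apply: le_trans (qP _ _ mk.2) _.
  by rewrite ler_nat; apply: d_mono; exact: Hb.
exists c; split => [m|l].
  apply: c_small => k [Nk Mk]; have : (block_radius k <= block_center k)%N.
    exact: leq_addl.
  by move: Nk; rewrite /N; lia.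
(* The odd factor [3 ^ N l] exceeds [N l] and leaves the valuation equal to [l]; [idx] then
   enumerates the [k] for which [k + 1] has valuation exactly [v]. *)
pose v := (2 ^ l * 3 ^ N l)%N.
pose idx t := (2 ^ v * t.*2.+1).-1.
have idxE t : (idx t).+1 = (2 ^ v * t.*2.+1)%N by rewrite prednK // muln_gt0 expn_gt0.
have log_idx t : logn 2 (idx t).+1 = v.
  rewrite idxE lognM ?expn_gt0 // pfactorK // logn_coprime ?addn0 //.
  by rewrite coprime2n /= odd_double.
have pat_idx t : pattern_of (idx t) = l.
  rewrite /pattern_of log_idx lognM ?expn_gt0 // pfactorK // logn_coprime ?addn0 //.
  by rewrite coprime2n oddX orbT.
have wide t : (N l <= block_radius (idx t))%N.
  rewrite /block_radius log_idx /v; apply: leqW.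
  apply: leq_trans (ltnW (ltn_expl (N l) (isT : 1 < 3)%N)) _.
  by rewrite leq_pmull // expn_gt0.
apply: (@positive_lower_density_increasing _ (fun t => block_center (idx t))
          (8 * 2 ^ v)%N) => [t|t k|t].
- have /block_center_sep : (idx t < idx t.+1)%N.
    by rewrite -ltnS !idxE ltn_mul2l expn_gt0 /=; lia.
  by rewrite /block_radius; lia.
- split => kM.
    have hk : hit ((block_center (idx t))%:Z + k) (idx t).
      by split; rewrite pat_idx ?wide // addrC addKr.
    by rewrite ((cP _).1 _ hk) pat_idx addrC addKr.
  apply: c_small => i [Ni Mi].
  have [it|it|it] := ltngtP i (idx t).
  + have := block_center_sep it; move: Ni; rewrite /N; lia.
  + have := block_center_sep it; move: Ni; rewrite /N; lia.
  + by move: Mi; rewrite it pat_idx addrC addKr leqNgt kM.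
- by have := block_center_lt (idx t); rewrite idxE; lia.
Qed.

End FrequentPatterns.

(** * Unconditional bases *)

Lemma archimedean_inv_small (K : numFieldType) (eps : K) :
  archimedean_norm K -> 0 < eps ->
  exists n0 : nat, forall n, (n0 <= n)%N -> n.+1%:R^-1 < eps.
Proof.
move=> archK eps0; have [n0] := archK eps^-1.
rewrite ger0_norm ?invr_ge0 ?ltW // => n0P.
exists n0 => n n0n; rewrite invf_plt ?posrE ?ltr0Sn //.
by apply: lt_trans n0P _; rewrite ltr_nat.
Qed.

Lemma seq_int_bounded (F : seq int) :
  exists B : nat, forall k, k \in F -> (`|k| <= B)%N.
Proof.
elim: F => [|a F [B BP]]; first by exists 0%N.
exists (maxn `|a|%N B) => k; rewrite inE => /orP[/eqP ->|/BP]; lia.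
Qed.

Section UnconditionalBasis.
Variables (K : numFieldType) (X : tvsType K) (co : X -> int -> K) (f : int -> X).
Hypothesis archK : archimedean_norm K.
Hypothesis seqX : frechet_sequence_space co.
Hypothesis unitf : unit_sequences co f.
Hypothesis basisf : unconditional_basis co f.
Implicit Types (U V W : set X) (x y z : X) (F r : seq int).

Let frechetX : frechet_space X. Proof. by case: seqX. Qed.
Let co_inj : injective co. Proof. by case: seqX. Qed.
Let co_cont k : continuous (fun x => co x k). Proof. by case: seqX. Qed.

Lemma coordD x y k : co (x + y) k = co x k + co y k.
Proof. by case: seqX => _ lin _ _; have := lin 1 x y k; rewrite scale1r mul1r. Qed.

Lemma coord0 k : co 0 k = 0.
Proof. by have := coordD 0 0 k; rewrite addr0 -{1}[co 0 k]addr0 => /addrI <-. Qed.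

Lemma coordZ (a : K) x k : co (a *: x) k = a * co x k.
Proof. by case: seqX => _ lin _ _; have := lin a x 0 k; rewrite !coord0 !addr0. Qed.

Lemma coordB x y k : co (x - y) k = co x k - co y k.
Proof. by rewrite coordD -scaleN1r coordZ mulN1r. Qed.

Lemma coord_sum (I : Type) (s : seq I) (Q : pred I) (u : I -> X) k :
  co (\sum_(i <- s | Q i) u i) k = \sum_(i <- s | Q i) co (u i) k.
Proof.
apply: (big_morph (fun z => co z k)); last exact: coord0.
by move=> x y; exact: coordD.
Qed.

Lemma coord_ext x y : (forall k, co x k = co y k) -> x = y.
Proof. by move=> xy; apply: co_inj; apply/funext. Qed.

Lemma coord_comb (c : int -> K) r k : uniq r ->
  co (\sum_(i <- r) c i *: f i) k = if k \in r then c k else 0.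
Proof.
move=> ur; rewrite coord_sum.
under eq_bigr do rewrite coordZ unitf.
have [kr|kr] := ifPn.
  rewrite (bigD1_seq k) //= eqxx mulr1 big1 ?addr0 // => i ik.
  by rewrite eq_sym (negbTE ik) mulr0.
rewrite big_seq big1 // => i ir; have [ki|] := eqVneq k i; last by rewrite mulr0.
by rewrite ki ir in kr.
Qed.

Lemma coord_nbhs y k (eps : K) :
  0 < eps -> nbhs y [set z | `|co y k - co z k| < eps].
Proof.
move=> eps0; have := @co_cont k y [set t : K | `|co y k - t| < eps]; apply.
by apply/nbhs_ballP; exists eps => // t; rewrite -ball_normE.
Qed.

Definition proj F z := \sum_(k <- F) co z k *: f k.

Lemma projD F x y : proj F (x + y) = proj F x + proj F y.
Proof. by rewrite -big_split; apply: eq_bigr => k _; rewrite coordD scalerDl. Qed.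

Lemma projZ F (a : K) x : proj F (a *: x) = a *: proj F x.
Proof. by rewrite scaler_sumr; apply: eq_bigr => k _; rewrite coordZ scalerA. Qed.

Lemma comb_small r U : nbhs (0 : X) U -> exists2 eps : K, 0 < eps &
  forall c : int -> K, (forall k, k \in r -> `|c k| < eps) ->
    U (\sum_(k <- r) c k *: f k).
Proof.
elim: r U => [|a r IH] U U0.
  by exists 1 => // c _; rewrite big_nil; exact: nbhs_singleton.
have [V V0 VU] := nbhs0_add U0; have [e1 e10 e1P] := IH V V0.
have [e2 e20 e2P] := nbhs0_absorbing (f a) V0.
(* [K] is only partially ordered, but positive elements are real and hence comparable. *)
have e12 : e1 >=< e2 by apply: real_comparable; exact: gtr0_real.
exists (Num.min e1 e2).
  by rewrite comparable_lt_min ?e10 // real_comparable ?gtr0_real.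
move=> c cP; rewrite big_cons; apply: VU.
  have := cP a (mem_head _ _); rewrite comparable_lt_min // => /andP[_]; exact: e2P.
apply: e1P => k kr; have := cP k; rewrite inE kr orbT comparable_lt_min //.
by move=> /(_ isT) /andP[].
Qed.

Lemma proj_continuous0 F U : nbhs (0 : X) U -> nbhs (0 : X) [set z | U (proj F z)].
Proof.
move=> U0; have [eps eps0 epsP] := comb_small F U0.
have coF : nbhs (0 : X) [set z | forall k, k \in F -> `|co z k| < eps].
  elim: (F) => [|a r IH]; first by apply: filterS (@filterT _ _ _).
  have Ha : nbhs (0 : X) [set z | `|co z a| < eps].
    apply: filterS (coord_nbhs 0 a eps0) => z /=.
    by rewrite coord0 sub0r normrN.
  apply: filterS2 Ha IH => z za zr k; rewrite inE => /orP[/eqP ->//|]; exact: zr.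
by apply: filterS coF => z zF; exact: epsP.
Qed.

(** Compares the partial sums over [F0] and over [F0] enlarged by [F]. *)
Lemma proj_cauchy z U : nbhs (0 : X) U -> exists F0, forall F, uniq F ->
  (forall k, k \in F -> k \notin F0) -> U (proj F z).
Proof.
move=> /nbhs0_sub[V V0 VU]; have [F0 F0P] := basisf (nbhs_translate z V0).
exists F0 => F uF FF0.
have := F0P (undup F0 ++ F); rewrite cat_uniq undup_uniq uF andbT /=.
have -> : ~~ has (mem (undup F0)) F.
  by apply/hasPn => k /FF0; rewrite /= mem_undup.
have sub1 : {subset F0 <= undup F0 ++ F} by move=> k; rewrite mem_cat mem_undup => ->.
have sub2 : {subset F0 <= undup F0} by move=> k; rewrite mem_undup.
move=> /(_ isT sub1) H1; have H2 := F0P _ (undup_uniq F0) sub2.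
by have := VU _ _ H1 H2; rewrite opprB addrA subrK big_cat /= [X in X - _]addrC addrK.
Qed.

Lemma subsums_absorbed z r U : nbhs (0 : X) U -> exists n0, forall n (Q : pred int),
  (n0 <= n)%N -> U (n.+1%:R^-1 *: \sum_(k <- r | Q k) co z k *: f k).
Proof.
elim: r U => [|a r IH] U U0.
  by exists 0%N => n Q _; rewrite big_nil scaler0; exact: nbhs_singleton.
have [V V0 VU] := nbhs0_add U0; have [n1 n1P] := IH V V0.
have [eps eps0 epsP] := nbhs0_absorbing (co z a *: f a) V0.
have [n2 n2P] := archimedean_inv_small archK eps0.
exists (maxn n1 n2) => n Q; rewrite geq_max => /andP[n1n n2n].
rewrite big_cons; case: ifP => _; last first.
  rewrite -[X in U X]add0r; apply: VU; [exact: nbhs_singleton|exact: n1P].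
rewrite scalerDr; apply: VU; last exact: n1P.
by apply: epsP; rewrite ger0_norm ?n2P // invr_ge0.
Qed.

(** Pointwise boundedness for Banach-Steinhaus: inside [F0] there are finitely many subsums, and
    outside it the projection is already small and stays so when shrunk, by convexity. *)
Lemma proj_bounded z U : nbhs (0 : X) U -> exists n : nat,
  forall F : {F : seq int | uniq F}, U (n.+1%:R^-1 *: proj (val F) z).
Proof.
move=> /nbhs0_add[V V0 VU]; have [W Wc WV] := nbhs0_convex V0.
have [F0 F0P] := proj_cauchy z Wc.1.
have [n nP] := subsums_absorbed z (undup F0) V0.
exists n => -[F uF] /=; rewrite /proj (bigID (mem F0)) /= scalerDr; apply: VU.
  rewrite -big_filter (perm_big [seq k <- undup F0 | k \in F]).
    by rewrite big_filter; exact: nP.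
  apply: uniq_perm; rewrite ?filter_uniq ?undup_uniq // => k.
  by rewrite !mem_filter mem_undup andbC.
apply: WV; apply: convex_nbhs0_scale => //.
  by rewrite invr_ge0 ler0n invf_le1 ?ltr0Sn // ler1n.
rewrite -big_filter; apply: F0P; first exact: filter_uniq.
by move=> k; rewrite mem_filter => /andP[].
Qed.

Lemma proj_equicontinuous U : nbhs (0 : X) U -> exists2 W, nbhs (0 : X) W &
  forall F z, uniq F -> W z -> U (proj F z).
Proof.
move=> U0.
have [|||W W0 WU] := @banach_steinhaus K X {F : seq int | uniq F}
  (fun F : {F : seq int | uniq F} => proj (val F)) frechetX _ _ _ proj_bounded U U0.
- by move=> F x y; exact: projD.
- by move=> F c x; exact: projZ.
- by move=> F V; exact: proj_continuous0.
by exists W => // F z uF; exact: (WU (exist _ F uF)).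
Qed.

(** [z] is close to one of its own projections; this turns estimates on finite sums into estimates
    on vectors. *)
Lemma nbhs0_proj U : nbhs (0 : X) U -> exists2 V, nbhs (0 : X) V &
  forall z, (forall F, uniq F -> V (proj F z)) -> U z.
Proof.
move=> /nbhs0_sub[V V0 VU]; exists V => // z Vz.
have [F0 F0P] := basisf (nbhs_translate z V0).
have H := F0P _ (undup_uniq F0) (fun k => _ : k \in F0 -> k \in undup F0).
have := VU _ _ (Vz _ (undup_uniq F0)) (H _); rewrite opprB addrC subrK; apply.
by move=> k; rewrite mem_undup.
Qed.

Lemma coord_neq0 y : y != 0 -> exists j, co y j != 0.
Proof.
move=> y0; apply: contrapT => H; move/eqP: y0; apply; apply: coord_ext => k.
rewrite coord0; apply: contrapT => /eqP yk; by apply: H; exists k.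
Qed.

End UnconditionalBasis.

(** * Dynamics of the unweighted shift *)

Section UnweightedShift.
Variables (K : numFieldType) (X : tvsType K) (co : X -> int -> K) (f : int -> X).
Variable (T : X -> X).
Hypothesis archK : archimedean_norm K.
Hypothesis spanK : unit_ball_in_positive_span K.
Hypothesis sepK : separable_scalars K.
Hypothesis seqX : frechet_sequence_space co.
Hypothesis unitf : unit_sequences co f.
Hypothesis basisf : unconditional_basis co f.
Hypothesis shiftT : forall x k, co (T x) k = co x (k + 1).
Hypothesis contT : continuous T.
Implicit Types (U V W : set X) (x y z : X) (F r : seq int).

Lemma coord_iter n x k : co (iter n T x) k = co x (k + n%:Z).
Proof.
elim: n k => [|n IH] k /=; first by rewrite addr0.
by rewrite shiftT IH; congr (co x _); lia.
Qed.

Lemma iter_shift_nbhs0 n U : nbhs (0 : X) U -> nbhs (0 : X) [set z | U (iter n T z)].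
Proof.
have T0 : T 0 = 0.
  by apply: (coord_ext seqX) => k; rewrite shiftT !(coord0 seqX).
elim: n U => // n IH U U0 /=.
have : nbhs (0 : X) [set z | U (T z)] by apply: contT; rewrite T0.
by move=> /IH.
Qed.

Lemma iter_shift_units n r (Q : pred int) :
  iter n T (\sum_(k <- r | Q k) f (k + n%:Z)) = \sum_(k <- r | Q k) f k.
Proof.
apply: (coord_ext seqX) => j; rewrite coord_iter !(coord_sum seqX).
by apply: eq_bigr => k _; rewrite !unitf (inj_eq (addIr _)).
Qed.

(* The units over [F] are obtained by applying powers [T^i], [i < N], to
   combinations of units on which the coordinates of [z] are bounded below. *)
Lemma syndetic_units (N C : nat) U : nbhs (0 : X) U ->
  exists2 V, nbhs (0 : X) V & forall z F, uniq F ->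
    (forall k, k \in F -> exists2 i, (i < N)%N &
      co z (k + i%:Z) != 0 /\ `|(co z (k + i%:Z))^-1| <= C%:R) ->
    (forall F', uniq F' -> (forall k', k' \in F' -> exists k i,
        [/\ k \in F, (i < N)%N & k' = k + i%:Z]) -> V (proj co f F' z)) ->
    U (\sum_(k <- F) f k).
Proof.
move=> /(nbhs0_sum N)[V1 V10 V1U].
have V20 : nbhs (0 : X) [set u | forall i : 'I_N, V1 (iter i T u)].
  by apply: filter_forall => i; exact: iter_shift_nbhs0.
have [V V0 VP] := bounded_multipliers C spanK V20.
exists V => // z F uF Fz FV.
have /choice[idx idxP] : forall k, exists i, k \in F -> (i < N)%N /\
    (co z (k + i%:Z) != 0 /\ `|(co z (k + i%:Z))^-1| <= C%:R).
  move=> k; have [kF|] := boolP (k \in F); last by exists 0%N.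
  by have [i iN H] := Fz k kF; exists i.
(* Group the positions by the power of [T] attached to them; each group is [T^i] of a sum of units
   where [z] is bounded below. *)
pose a i := \sum_(k <- F | idx k == i) f k.
have -> : \sum_(k <- F) f k = \sum_(i < N) a i.
  under [RHS]eq_bigr do rewrite /a big_mkcond.
  rewrite exchange_big /= big_seq [RHS]big_seq; apply: eq_bigr => k kF.
  by rewrite -big_mkcond (big_pred1 (Ordinal (idxP k kF).1)).
apply: V1U => i iN; rewrite /a -(iter_shift_units i).
pose r := [seq k + i%:Z | k <- F & idx k == i].
have ur : uniq r by rewrite map_inj_uniq ?filter_uniq //; exact: addIr.
have rP m : m \in r -> [/\ co z m != 0, `|(co z m)^-1| <= C%:R &
    exists k j, [/\ k \in F, (j < N)%N & m = k + j%:Z]].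
  move=> /mapP[k]; rewrite mem_filter => /andP[/eqP ki kF] ->.
  have := (idxP k kF).2; rewrite ki => -[? ?]; split => //.
  by exists k, i.
(* The inverse coordinates are the bounded multipliers, and subset sums of the remaining terms are
   again projections of [z]. *)
have -> : \sum_(k <- F | idx k == i) f (k + i%:Z) =
    \sum_(m <- r) (co z m)^-1 *: (co z m *: f m).
  rewrite -big_filter -(big_map (fun k => k + i%:Z) xpredT f).
  by apply: eq_big_seq => m /rP[m0 _ _]; rewrite scalerA mulVf ?scale1r.
apply: (VP _ _ _ ur _ _ (Ordinal iN)) => [m /rP[]//|Q].
rewrite -big_filter; apply: FV; first exact: filter_uniq.
by move=> m; rewrite mem_filter => /andP[_ /rP[]].
Qed.

(** * Unconditional convergence of the sum of the units *)

Hypothesis recurrence : exists x y, y != 0 /\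
  forall V, nbhs y V -> syndetic [set n | V (iter n T x)].

Lemma units_summable U : nbhs (0 : X) U -> exists M : nat, forall F, uniq F ->
  (forall k, k \in F -> (M <= `|k|)%N) -> U (\sum_(k <- F) f k).
Proof.
have [x [y [y0 xy]]] := recurrence; have [j yj] := coord_neq0 seqX y0.
set b := co y j in yj; have b0 : 0 < `|b| / 2 by rewrite divr_gt0 ?normr_gt0.
have [C CP] := archK (`|b| / 2)^-1.
(* When [T^k x] is near [y], [co x (j + k)] has modulus at least [|b| / 2]; bounded gaps give such
   an index in every window of length [N] starting at or after [j]. *)
have [N NP] : exists N : nat, forall m : int, j <= m -> exists2 i, (i < N)%N &
    co x (m + i%:Z) != 0 /\ `|(co x (m + i%:Z))^-1| <= C%:R.
  have [|_ [N NP]] := xy [set z | `|b - co z j| < `|b| / 2].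
    exact: coord_nbhs.
  exists N => m jm; have [k [mk /= bk]] := NP `|(m - j)%R|%N.
  exists (k - `|(m - j)%R|)%N; first by lia.
  have -> : m + (k - `|(m - j)%R|)%N%:Z = j + k%:Z by lia.
  move: bk; rewrite coord_iter => bk.
  have big : `|b| / 2 <= `|co x (j + k%:Z)|.
    rewrite -(lerD2l (`|b| / 2)) -splitr -lerBlDr.
    have := lerB_dist b (co x (j + k%:Z)) => /le_trans; apply.
    exact: ltW.
  have x0 : 0 < `|co x (j + k%:Z)| by exact: lt_le_trans big.
  split; first by rewrite -normr_gt0.
  rewrite normfV; apply: le_trans (ltW CP).
  by rewrite [leRHS]ger0_norm ?invr_ge0 ?(ltW b0) // lef_pV2 ?posrE.
move=> U0; have [V V0 VP] := syndetic_units N C U0.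
have [V2 V20 V2V] := nbhs0_add V0.
have [W W0 WP] := proj_equicontinuous archK seqX basisf V20.
have [F0 F0P] := proj_cauchy basisf y V20.
have [Mb MbP] := seq_int_bounded F0.
(* The margin [N] keeps the shifted positions [k + i] beyond [Mb], hence outside [F0]. *)
exists (Mb + N).+1 => F uF FM; have [B BP] := seq_int_bounded F.
have [_ [N' N'P]] := xy _ (nbhs_translate y W0).
(* [n] depends on [F], since it must move all of [F] to the right of [j]; by equicontinuity [W] does
   not. *)
have [n [Bn /= Wn]] := N'P (B + `|j|)%N.
apply: (VP (iter n T x)) => //.
  move=> k kF; have [|i iN iP] := NP (k + n%:Z); first by have := BP k kF; lia.
  by exists i => //; rewrite coord_iter addrAC.
move=> F' uF' F'F; rewrite -[iter n T x](subrK y) (projD _ seqX); apply: V2V.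
  exact: WP.
apply: F0P => // k' /F'F[k [i [kF iN ->]]]; apply/negP => /MbP.
by have := FM k kF; lia.
Qed.

Lemma bounded_combs_summable (C : nat) U : nbhs (0 : X) U -> exists M : nat,
  forall F (c : int -> K), uniq F -> (forall k, k \in F -> (M <= `|k|)%N) ->
  (forall k, k \in F -> `|c k| <= C%:R) -> U (\sum_(k <- F) c k *: f k).
Proof.
move=> /(bounded_multipliers C spanK)[V V0 VU].
have [M MP] := units_summable V0; exists M => F c uF FM cC.
apply: VU => // Q; rewrite -big_filter; apply: MP; first exact: filter_uniq.
by move=> k; rewrite mem_filter => /andP[_ /FM].
Qed.

(* Coefficients may even tend to infinity, slowly: [d] is at most [J] up to the
   index [m J.+1] after which combinations bounded by [J.+1] are negligible. *)
Lemma growing_combs_summable : exists d : nat -> nat,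
  [/\ forall m n, (m <= n)%N -> (d m <= d n)%N,
      forall C, exists n, (C <= d n)%N &
      forall U, nbhs (0 : X) U -> exists M : nat, forall F (c : int -> K), uniq F ->
        (forall k, k \in F -> (M <= `|k|)%N) ->
        (forall k, k \in F -> `|c k| <= (d `|k|%N)%:R) ->
        U (\sum_(k <- F) c k *: f k)].
Proof.
have [[_ [B [B0 Bbase]] _] _ _ _] := seqX.
pose rel (s : nat * set X) V := nbhs (0 : X) s.2 ->
  [/\ nbhs (0 : X) V, V `<=` B s.1 & forall a b, V a -> V b -> s.2 (a + b)].
have /choice[next nextP] : forall s, exists V, rel s V.
  move=> [n W]; have [W0|W0] := pselect (nbhs (0 : X) W); last by exists W => /W0.
  have [V V0 VW] := nbhs0_add W0; exists (V `&` B n) => _; split.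
  - exact: filterI.
  - by move=> z [].
  - by move=> a b [Va _] [Vb _]; exact: VW.
(* Thus [V n.+1 + V n.+1] lies in [V n], and [V n.+1] in [B n]. *)
pose V := fix V n : set X := if n is n'.+1 then next (n', V n') else setT.
have V0 n : nbhs (0 : X) (V n).
  elim: n => [|n IH] /=; first exact: filterT.
  by have [] := nextP (n, V n) IH.
have VP n := nextP (n, V n) (V0 n).
have /choice[M MP] := fun J => bounded_combs_summable J (V0 J.+1).
pose m J := (\sum_(i < J.+1) (M i).+1)%N.
have mS J : (m J < m J.+1)%N.
  by rewrite /m [X in (_ < X)%N]big_ord_recr /= -addn1 leq_add2l.
have m_mono i J : (i <= J)%N -> (m i <= m J)%N.
  by apply: (homo_leq leqnn leq_trans) => k; exact: ltnW.
have Mm J : (M J <= m J)%N.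
  by rewrite /m big_ord_recr /= addnS; apply: leqW; exact: leq_addl.
have Jm J : (J <= m J)%N by elim: J => // J IH; exact: leq_ltn_trans IH (mS J).
pose d n := (\max_(i < n.+1 | (m i <= n)%N) i)%N.
have d_le J n : (n < m J.+1)%N -> (d n <= J)%N.
  move=> nJ; apply/bigmax_leqP => i mi; rewrite leqNgt; apply/negP => /m_mono.
  by lia.
(* Peel off the shell [m J <= |k| < m J.+1], where coefficients are at most [J]: the shell and the
   remainder both land in [V J.+1]. *)
have tail n J F (c : int -> K) : uniq F ->
    (forall k, k \in F -> (m J <= `|k| < m (J + n))%N) ->
    (forall k, k \in F -> `|c k| <= (d `|k|%N)%:R) ->
    V J (\sum_(k <- F) c k *: f k).
  elim: n J F => [|n IH] J F uF FJ Fd.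
    case: F FJ {uF Fd} => [|k F] FJ; first by rewrite big_nil; exact: nbhs_singleton.
    by have := FJ k (mem_head _ _); rewrite addn0; lia.
  have [_ _ addV] := VP J; rewrite (bigID (fun k : int => (`|k| < m J.+1)%N)) /=.
  rewrite -[X in X + _]big_filter -[X in _ + X]big_filter; apply: addV; rewrite /=.
    apply: MP; rewrite ?filter_uniq // => k; rewrite mem_filter => /andP[kJ kF].
      by have := FJ k kF; have := Mm J; lia.
    by apply: le_trans (Fd k kF) _; rewrite ler_nat; exact: d_le.
  apply: (IH J.+1); rewrite ?filter_uniq // => k; rewrite mem_filter => /andP[kJ kF].
    by have := FJ k kF; rewrite addSnnS; lia.
  exact: Fd.
exists d; split.
- move=> a b ab; apply/bigmax_leqP => i mi.
  have ib : (i < b.+1)%N by have := ltn_ord i; lia.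
  by apply: (leq_bigmax_cond (Ordinal ib)) => /=; lia.
- move=> C; exists (m C); have Cm : (C < (m C).+1)%N by rewrite ltnS.
  exact: (leq_bigmax_cond (Ordinal Cm)).
- move=> U U0; have [j jU] := Bbase U U0; exists (m j.+1) => F c uF Fm Fd.
  have [B' B'P] := seq_int_bounded F.
  apply: jU; have [_ H _] := VP j; apply: H => /=.
  apply: (tail B'.+1 j.+1) => // k kF; rewrite Fm //=.
  have := B'P k kF; have := Jm (j.+1 + B'.+1)%N; lia.
Qed.

Lemma comb_interval_sub (c : int -> K) (M m : nat) : (M <= m)%N ->
  \sum_(k <- int_interval m) c k *: f k - \sum_(k <- int_interval M) c k *: f k =
  \sum_(k <- [seq k <- int_interval m | (M < `|k|)%N]) c k *: f k.
Proof.
move=> Mm; rewrite [RHS]big_filter (bigID (fun k : int => (`|k| <= M)%N)) /=.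
rewrite -big_filter (perm_big (int_interval M)); last first.
  apply: uniq_perm; rewrite ?filter_uniq ?int_interval_uniq // => k.
  by rewrite mem_filter !mem_int_interval; lia.
by rewrite [X in X - _]addrC addrK; apply: eq_bigl => k; rewrite ltnNge.
Qed.

(** Completeness sums the series over [[-n, n]], and continuity of the coordinates identifies the
    limit. *)
Lemma dominated_sequences : exists d : nat -> nat,
  [/\ forall m n, (m <= n)%N -> (d m <= d n)%N,
      forall C, exists n, (C <= d n)%N,
      forall c : int -> K, (forall k, `|c k| <= (d `|k|%N)%:R) ->
        exists x, forall k, co x k = c k &
      forall U, nbhs (0 : X) U -> exists M : nat, forall z,
        (forall k, (`|k| <= M)%N -> co z k = 0) ->
        (forall k, (M < `|k|)%N -> `|co z k| <= (d `|k|%N)%:R) -> U z].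
Proof.
have [d [d_mono d_unb dP]] := growing_combs_summable.
exists d; split=> //.
- move=> c cd; have [[_ _ complete] _ _ _] := seqX.
  pose u n := \sum_(k <- int_interval n) c k *: f k.
  have [|x ux] := complete u.
    move=> U /nbhs0_sub[V V0 VU]; have [M MP] := dP V V0.
    have uM n : (M <= n)%N -> V (u n - u M).
      move=> Mn; rewrite comb_interval_sub //; apply: MP => //.
        by rewrite filter_uniq ?int_interval_uniq.
      by move=> k; rewrite mem_filter => /andP[/ltnW].
    exists M => m n /uM Vm /uM Vn.
    by have := VU _ _ Vm Vn; rewrite opprB addrA subrK.
  exists x => k; apply: contrapT => /eqP neq.
  have eps0 : 0 < `|co x k - c k| by rewrite normr_gt0 subr_eq0.
  have /ux := coord_nbhs seqX x k eps0.
  move=> [n _ /(_ (maxn n `|k|%N))] /=; rewrite leq_maxl => /(_ isT).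
  rewrite (coord_comb seqX unitf) ?int_interval_uniq // mem_int_interval leq_maxr.
  by rewrite ltxx.
- move=> U /(nbhs0_proj basisf)[V V0 VU]; have [M MP] := dP V V0.
  exists M => z z0 zd; apply: VU => F uF.
  rewrite /proj (bigID (fun k : int => (M < `|k|)%N)) /= [X in _ + X]big1 ?addr0.
    rewrite -big_filter; apply: MP; first exact: filter_uniq.
      by move=> k; rewrite mem_filter => /andP[/ltnW].
    by move=> k; rewrite mem_filter => /andP[/zd].
  by move=> k; rewrite -leqNgt => /z0 ->; rewrite scale0r.
Qed.

(** * Periodic points and a frequently hypercyclic vector *)

Lemma truncation y V : nbhs (0 : X) V -> exists M0 : nat, forall M, (M0 <= M)%N ->
  V (proj co f (int_interval M) y - y).
Proof.
move=> V0; have [F0 F0P] := basisf (nbhs_translate y V0).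
have [M0 M0P] := seq_int_bounded F0; exists M0 => M M0M.
apply: F0P; first exact: int_interval_uniq.
by move=> k /M0P kM0; rewrite mem_int_interval; exact: leq_trans M0M.
Qed.

Lemma periodic_points_dense : dense (periodic_points T).
Proof.
have [d [d_mono d_unb dex dsmall]] := dominated_sequences.
move=> O [y Oy] oO; have /nbhs0_translate : nbhs y O by apply: open_nbhs_nbhs.
move=> /nbhs0_add[V V0 VO].
have [M0 /(_ M0 (leqnn _)) yM0] := truncation y V0.
have [C CP] := archK (\sum_(k <- int_interval M0) `|co y k|).
have co_le k : (`|k| <= M0)%N -> `|co y k| <= C%:R.
  rewrite -mem_int_interval => kM0; apply: le_trans (ltW CP).
  rewrite [leRHS]ger0_norm; last by apply: sumr_ge0 => *.
  rewrite (bigD1_seq k) ?int_interval_uniq //= lerDl.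
  by apply: sumr_ge0 => *.
have [M1 M1P] := dsmall V V0; have [q qC] := d_unb C.
(* Beyond [M] the truncation vanishes ([M0]), dominated vectors are negligible ([M1]), and [d] is at
   least [C] ([q]). *)
pose M := maxn M0 (maxn M1 q).
pose P : int := M.*2.+1%:Z.
(* The representative of [k] modulo [P] in [[-M, M]], so [c] extends the truncation of [y]
   periodically. *)
pose res (k : int) : int := ((k + M%:Z) %% P)%Z - M%:Z.
pose c k := if (`|res k| <= M0)%N then co y (res k) else 0.
have resP k : (`|k| <= M)%N -> res k = k.
  by move=> kM; rewrite /res modz_small /P ?addrK //; apply/andP; lia.
have c_le k : `|c k| <= C%:R.
  by rewrite /c; case: ifPn => [/co_le//|_]; rewrite normr0.
(* Near the origin [c] may exceed [d], so the window [[-M, M]] is left to [y0] and [z] realises only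
   the rest. *)
have [z zP] : exists z, forall k, co z k = if (`|k| <= M)%N then 0 else c k.
  apply: dex => k; case: leqP => kM; first by rewrite normr0.
  apply: le_trans (c_le k) _; rewrite ler_nat; apply: leq_trans qC _.
  by apply: d_mono; rewrite /M in kM; lia.
pose y0 := proj co f (int_interval M0) y.
have pP k : co (y0 + z) k = c k.
  rewrite (coordD seqX) zP (coord_comb seqX unitf) ?int_interval_uniq //.
  rewrite mem_int_interval; case: (leqP `|k|%N M) => kM.
    by rewrite addr0 /c resP.
  by rewrite ifF ?add0r //; apply/negbTE; rewrite -ltnNge; rewrite /M in kM; lia.
exists (y0 + z); split.
  rewrite -[y0](subrK y) addrAC addrC; apply: VO => //.
  apply: M1P => k kM1; rewrite zP; first by rewrite ifT //; lia.
  case: leqP => kM; first by rewrite normr0.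
  apply: le_trans (c_le k) _; rewrite ler_nat; apply: leq_trans qC _.
  by apply: d_mono; rewrite /M in kM; lia.
exists M.*2.+1; split => //; apply: (coord_ext seqX) => k.
rewrite coord_iter !pP /c /res.
suff -> : ((k + P + M%:Z) %% P)%Z = ((k + M%:Z) %% P)%Z by [].
by rewrite addrAC modzDr.
Qed.

Lemma shift_frequently_hypercyclic : frequently_hypercyclic T.
Proof.
have [d [d_mono d_unb dex dsmall]] := dominated_sequences.
have [q qP] := sepK.
(* [l] encodes a radius and a list of indices into the dense sequence [q], read from the left end of
   the window; numbers encoding nothing get a default. *)
pose pat (l : nat) : nat * seq nat := odflt (0%N, [::]) (unpickle l).
pose p l (k : int) := q (nth 0%N (pat l).2 `|(k + (pat l).1%:Z)%R|%N).
have [c [cd cP]] := frequent_patterns (fun l => (pat l).1) p archK d_mono d_unb.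
have [x xP] := dex c cd; exists x => O oO [y Oy].
have /nbhs0_translate : nbhs y O by apply: open_nbhs_nbhs.
move=> /(nbhs0_sum 3)[V V0 VO].
have [M0 M0P] := truncation y V0; have [M1 M1P] := dsmall V V0.
pose M := maxn M0 M1.
have [eps eps0 epsP] := comb_small f (int_interval M) V0.
have /choice[s sP] := fun k : int => qP (co y k) eps eps0.
pose codes := [seq s (i%:Z - M%:Z) | i <- iota 0 M.*2.+1].
pose l := pickle (M, codes).
have patl : pat l = (M, codes) by rewrite /pat pickleK.
have pl k : (`|k| <= M)%N -> p l k = q (s k).
  move=> kM; rewrite /p patl /= /codes (nth_map 0%N) ?size_iota; last by lia.
  by rewrite nth_iota; [congr (q (s _)); lia|lia].
apply: positive_lower_densityS (cP l) => n; rewrite patl /= => Hn.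
pose y0 := proj co f (int_interval M) y.
pose y1 := \sum_(k <- int_interval M) p l k *: f k.
have y1y0 : V (y1 - y0).
  rewrite /y1 /y0 /proj -sumrB.
  under eq_bigr do rewrite -scalerBl.
  apply: epsP => k; rewrite mem_int_interval => kM.
  by rewrite pl // distrC.
have zV : V (iter n T x - y1).
  have co1 k : co (iter n T x - y1) k =
      c (n%:Z + k) - if (`|k| <= M)%N then p l k else 0.
    rewrite (coordB seqX) coord_iter xP (coord_comb seqX unitf) ?int_interval_uniq //.
    by rewrite mem_int_interval (addrC k).
  apply: M1P => k kM; rewrite co1.
    by rewrite ifT ?(Hn k).1 ?subrr // /M; lia.
  case: leqP => kM'; first by rewrite (Hn k).1 // subrr normr0.
  by rewrite subr0; exact: (Hn k).2.
(* Three errors: truncating [y], approximating its coordinates by [q], and the part of [T^n x]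
   outside the window. *)
have := VO (fun i => nth 0 [:: y0 - y; y1 - y0; iter n T x - y1] i).
rewrite !big_ord_recl big_ord0 /= addr0.
rewrite [y1 - y0 + _]addrC subrKA [y0 - y + _]addrC subrKA [y + _]addrC subrK.
apply; case=> [|[|[|//]]] _ //=.
by apply: M0P; rewrite leq_maxl.
Qed.

End UnweightedShift.

Lemma frequently_hypercyclic_hypercyclic (X : topologicalType) (T : X -> X) :
  frequently_hypercyclic T -> hypercyclic T.
Proof.
move=> [x xP]; exists x => O O0 oO; have [k [_ [N0 H]]] := xP O oO O0.
have [[n On]|none] := pselect (exists n, O (iter n T x)).
  by exists (iter n T x); split => //; exists n.
(* [N0.+1] is positive, so the count up to it cannot vanish. *)
have := H N0.+1 (leqnSn _); rewrite /count_upto big1 ?muln0 //= => n _.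
by rewrite asboolF // => On; apply: none; exists n.
Qed.

(** * Weights and scalars *)

(* The solution of [v k = w (k + 1) * v (k + 1)] with [v 0 = 1]. *)
Definition shift_weights (K : numFieldType) (w : int -> K) (k : int) : K :=
  match k with
  | Posz n => (\prod_(i < n) w i.+1%:Z)^-1
  | Negz n => \prod_(i < n.+1) w (- i%:Z)
  end.

Lemma shift_weights_neq0 (K : numFieldType) (w : int -> K) k :
  (forall n, w n != 0) -> shift_weights w k != 0.
Proof.
by move=> w0; case: k => n /=; rewrite ?invr_eq0; apply/prodf_neq0 => i _.
Qed.

Lemma shift_weightsE (K : numFieldType) (w : int -> K) k :
  (forall n, w n != 0) ->
  shift_weights w k = w (k + 1) * shift_weights w (k + 1).
Proof.
move=> w0; case: k => [n|[|n]].
- have -> : Posz n + 1 = Posz n.+1 by lia.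
  by rewrite /= big_ord_recr /= invfM mulrCA divff ?mulr1.
- have -> : Negz 0 + 1 = Posz 0 by lia.
  by rewrite /= big_ord_recr !big_ord0 /= oppr0 invr1 mul1r mulr1.
- have -> : Negz n.+1 + 1 = Negz n by lia.
  by rewrite /= big_ord_recr mulrC /= NegzE.
Qed.

Lemma theorem3p3_scalars (K : numFieldType) :
  archimedean_norm K -> unit_ball_in_positive_span K -> separable_scalars K ->
  theorem3p3_over K.
Proof.
move=> archK spanK sepK X iota e w T [frX lin inj cont]
  unit_e basis_e w0 shift contT rec.
pose v := shift_weights w; have v0 k : v k != 0 by exact: shift_weights_neq0.
(* [X] and [T] stay the same; only the identification with sequences and the basis are rescaled. *)
pose co x k := iota x k / v k; pose f k := v k *: e k.
have iotaZ (a : K) x k : iota (a *: x) k = a * iota x k.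
  have iota0 : iota 0 k = 0.
    have := lin 1 0 0 k; rewrite scale1r addr0 mul1r.
    by rewrite -{1}[iota 0 k]addr0 => /addrI <-.
  by have := lin a x 0 k; rewrite addr0 iota0 addr0.
have seqX : frechet_sequence_space co.
  split => //.
  - by move=> a x y k; rewrite /co lin mulrDl mulrA.
  - move=> x y xy; apply: inj; apply/funext => k.
    by have /(congr1 (fun g => g k * v k)) := xy; rewrite /co !divfK.
  - by move=> k x; apply: cvgM; [exact: cont|exact: cvg_cst].
have unitf : unit_sequences co f.
  move=> n k; rewrite /co /f iotaZ unit_e.
  by have [->|_] := eqVneq k n; rewrite ?mulr1 ?divff // mulr0 mul0r.
have basisf : unconditional_basis co f.
  move=> x U Ux; have [F0 F0P] := basis_e x U Ux; exists F0 => F uF F0F.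
  by under eq_bigr do rewrite /co /f scalerA divfK //; exact: F0P.
have shiftT x k : co (T x) k = co x (k + 1).
  by rewrite /co shift /v (shift_weightsE k w0) invfM mulrACA divff ?mul1r.
have fhc := shift_frequently_hypercyclic archK spanK sepK seqX
  unitf basisf shiftT contT rec.
split => //; split; first exact: frequently_hypercyclic_hypercyclic.
exact: (periodic_points_dense archK spanK seqX unitf basisf shiftT contT rec).
Qed.

(** * Verification of the scalar conditions *)

Lemma real_archimedean_norm (R : realType) : archimedean_norm R.
Proof. by move=> z; exists (Num.bound `|z|); exact: archi_boundP. Qed.

Lemma real_parts (R : realType) (c : R) : `|c| <= 1 -> exists t s : R,
  [/\ 0 <= t <= 1, 0 <= s <= 1 & c = t - s].
Proof.
rewrite ler_norml => /andP[c1 c2]; have [c0|c0] := leP 0 c.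
  by exists c, 0; rewrite c0 c2 lexx ler01 subr0.
by exists 0, (- c); rewrite lexx ler01 oppr_ge0 (ltW c0) lerNl c1 sub0r opprK.
Qed.

Lemma real_unit_ball (R : realType) : unit_ball_in_positive_span R.
Proof.
exists (fun i => nth 0 [:: 1; -1; 0; 0] i) => c /real_parts[t [s [t01 s01 ->]]].
exists (fun i => nth 0 [:: t; s; 0; 0] i); split.
  by move=> [[|[|[|[|//]]]] ?] //=; rewrite lexx ler01.
by rewrite !big_ord_recl big_ord0 /=; ring.
Qed.

Lemma real_separable (R : realType) (z eps : R) : 0 < eps ->
  exists q : rat, `|z - ratr q| < eps.
Proof.
move=> eps0; have [|q] := @rat_in_itvoo R (z - eps) (z + eps).
  by lra.
rewrite in_itv /= => /andP[q1 q2]; exists q.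
by rewrite ltr_norml; lra.
Qed.

Lemma real_separable_scalars (R : realType) : separable_scalars R.
Proof.
exists (fun n => ratr (odflt 0 (unpickle n))) => z eps /(real_separable z)[q qP].
by exists (pickle q); rewrite pickleK.
Qed.

Section ComplexScalars.
Variable R : realType.
Local Open Scope complex_scope.

Lemma complex_archimedean_norm : archimedean_norm R[i].
Proof.
move=> z; rewrite normc_def.
set r := Num.sqrt _; exists (Num.bound r).
rewrite -(rmorph_nat (real_complex R)) ltcR; apply: archi_boundP; exact: sqrtr_ge0.
Qed.

Lemma normc_i : `|'i : R[i]| = 1.
Proof. by rewrite normc_def /= expr0n expr1n add0r sqrtr1. Qed.

Lemma complex_unit_ball : unit_ball_in_positive_span R[i].
Proof.
exists (fun i => nth 0 [:: 1; -1; 'i%C; - 'i%C] i) => c c1.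
have [|t [s [t01 s01 reE]]] := @real_parts R (complex.Re c).
  by rewrite -lecR; exact: le_trans (normc_ge_Re c) c1.
have [|t' [s' [t01' s01' imE]]] := @real_parts R (complex.Im c).
  rewrite -lecR; have := normc_ge_Re (c * 'i).
  rewrite ReiNIm normrN normrM => /le_trans; apply.
  by rewrite normc_i mulr1.
exists (fun i => nth 0 [:: t%:C; s%:C; t'%:C; s'%:C] i); split.
  by move=> [[|[|[|[|//]]]] ?] //=; rewrite ler0c lecR.
rewrite !big_ord_recl big_ord0 /= [LHS]complexE reE imE !rmorphB /=. ring.
Qed.

Lemma complex_separable_scalars : separable_scalars R[i].
Proof.
exists (fun n => let q := odflt (0, 0) (unpickle n) : rat * rat in
  (ratr q.1)%:C + 'i * (ratr q.2)%:C) => z eps eps0.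
(* A positive complex number is real, so [eps] can be halved between the real and imaginary
   parts. *)
have epsE : eps = (complex.Re eps)%:C by rewrite RRe_real // gtr0_real.
have e0 : 0 < complex.Re eps / 2 by rewrite divr_gt0 // -ltcR -epsE.
have [q1 q1P] := real_separable (complex.Re z) e0.
have [q2 q2P] := real_separable (complex.Im z) e0.
exists (pickle (q1, q2)); rewrite pickleK /= [z in z - _]complexE opprD addrACA.
have normC (a : R) : `|a%:C| = `|a|%:C.
  by rewrite normc_def /= expr0n addr0 sqrtr_sqr.
apply: le_lt_trans (ler_normD _ _) _.
rewrite -mulrBr normrM normc_i mul1r -!rmorphB !normC -rmorphD epsE ltcR.
by rewrite [ltRHS]splitr; exact: ltrD.
Qed.

End ComplexScalars.

(* Real case (K = R) and complex case (K = R[i]) for any model R of the reals. *)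
Theorem theorem3p3 :
  (forall R : realType, theorem3p3_over R) /\
  (forall R : realType, theorem3p3_over R[i]).
Proof.
split=> R; apply: theorem3p3_scalars.
- exact: real_archimedean_norm.
- exact: real_unit_ball.
- exact: real_separable_scalars.
- exact: complex_archimedean_norm.
- exact: complex_unit_ball.
- exact: complex_separable_scalars.
Qed.
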